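(* Let $n\ge 2$ be an integer and let $Q_{4n}=\langle x,y : x^{2n}=1,\ x^n=y^2,\ yx=x^{-1}y\rangle$ be the generalized quaternion group of order $4n$. Let $\Gamma_{Q_{4n}}$ be its non-commuting graph. Let $t_1,t_2$ be the two roots of the equation $(2n-2)x^2+(-4n+10)x-2n=0$. Then the spectrum of the distance signless Laplacian matrix $D^Q(\Gamma_{Q_{4n}})$ (eigenvalues counted with multiplicity, multiplicities being added if two of the listed values coincide) consists of: (a) $4n-4$ with multiplicity $n$; (b) $6n-8$ with multiplicity $2n-3$; (c) $4n-2$ with multiplicity $n-1$; (d) $t_k(2n-2)+(6n-2)$ with multiplicity $1$, for each $k=1,2$.
   Context: For a finite non-abelian group $G$ with centre $Z(G)$, the non-commuting graph $\Gamma_G$ is the simple undirected graph with vertex set $G\setminus Z(G)$, in which two distinct vertices $u,v$ are adjacent if and only if $uv\ne vu$. For a connected graph $H$, $d_{uv}$ denotes the length of a shortest path between $u$ and $v$; the distance matrix $D(H)$ has $(u,v)$-entry $d_{uv}$. The transmission of a vertex $v$ is $\sum_{u} d_{uv}$, and $Tr(H)$ is the diagonal matrix of vertex transmissions. The distance signless Laplacian matrix is $D^Q(H)=Tr(H)+D(H)$. *)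

(* Defs.v *)
From HB Require Import structures.
From mathcomp Require Import all_boot all_order all_algebra all_fingroup all_solvable.
Set Implicit Arguments. Unset Strict Implicit. Unset Printing Implicit Defensive.
Import GroupScope GRing.Theory.

Section NonCommutingGraph.
Variables (gT : finGroupType) (G : {group gT}).

Definition nc_vertices : {set gT} := G :\: 'Z(G).

Definition nc_adj (u v : gT) : bool :=
  [&& u \in nc_vertices, v \in nc_vertices, u != v & u * v != v * u].

Fixpoint nc_reach (k : nat) (u : gT) : {set gT} :=
  if k is k'.+1 then
    nc_reach k' u :|: [set w in nc_vertices | [exists v in nc_reach k' u, nc_adj v w]]
  else [set u].

(* length of a shortest path between u and v (the graph is assumed connected;
   any shortest path has length < #|gT|) *)
Definition nc_dist (u v : gT) : nat :=
  find (fun k => v \in nc_reach k u) (iota 0 #|gT|).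

Definition nc_trans (u : gT) : nat := \sum_(w in nc_vertices) nc_dist u w.

Definition nc_distQ (R : nzRingType) : 'M[R]_#|nc_vertices| :=
  \matrix_(i, j)
    (((i == j)%:R * (nc_trans (enum_val i))%:R)%R
     + (nc_dist (enum_val i) (enum_val j))%:R)%R.

End NonCommutingGraph.

(* Main.v *)
(* The vertices split as C = <x> \ Z(G), of size 2n-2, and <x>y, of size 2n.  An
   element a of <x> commutes with b y iff a^2 = 1, and a y commutes with b y iff
   a^2 = b^2, so inside <x>y each vertex commutes with exactly one other, while C is
   completely joined to <x>y; all distances are 1 or 2.  Hence X - D^Q = E - U V, where
   E is diag((X-6n+8) I, (X-4n+3) I - P) with P the matching on <x>y, and U has as
   columns the indicators of C and <x>y.  These are eigenvectors of E, so the matrix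
   determinant lemma leaves det E and a 2 x 2 determinant, whose roots are the two
   values built from t1 and t2. *)
Require Import Defs.
From HB Require Import structures.
From mathcomp Require Import all_boot all_order all_algebra all_fingroup all_solvable.
From mathcomp Require Import ring zify.
Import GroupScope GRing.Theory Num.Theory.
Local Open Scope ring_scope.

Set Implicit Arguments.
Unset Strict Implicit.

(** * Determinants *)

(* The matrix determinant lemma without division: when [F] is invertible,
   [V *m invmx E *m U = V *m U *m invmx F]. *)
Lemma det_sub_mulmx (S : comPzRingType) (N p : nat) (E : 'M[S]_N)
    (U : 'M_(N, p)) (V : 'M_(p, N)) (F : 'M_p) :
  E *m U = U *m F -> \det (E - U *m V) * \det F = \det E * \det (F - V *m U).
Proof.
move=> EU.
have eL : block_mx (E - U *m V) U 0 1%:M *m block_mx 1%:M 0 V 1%:M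
          = block_mx E U V 1%:M.
  by rewrite mulmx_block !mulmx1 !mulmx0 !mul1mx subrK !add0r.
(* The right factor clears the upper right corner, since [- E *m U + U *m F] vanishes by [EU]. *)
have eR : block_mx E U V 1%:M *m block_mx 1%:M (- U) 0 F
          = block_mx E 0 V (F - V *m U).
  rewrite mulmx_block !mulmx1 !mulmx0 !mulmxN EU !mul1mx !addr0 addNr.
  by rewrite (addrC (- _)).
have := congr1 determinant eR.
by rewrite -eL !det_mulmx !det_ublock !det_lblock !det1 !mul1r !mulr1.
Qed.

(** Subtracting the first block row from the second ([L]) and adding the second block column to the
    first ([T]) makes the matrix triangular; both operations have determinant 1. *)
Lemma det_block_scalarN1 (S : comPzRingType) (m : nat) (c : S) :
  \det (block_mx c%:M (- 1%:M) (- 1%:M) c%:M : 'M_(m + m))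
  = ((c - 1) * (c + 1)) ^+ m.
Proof.
pose L : 'M[S]_(m + m) := block_mx 1%:M 0 (- 1%:M) 1%:M.
pose T : 'M[S]_(m + m) := block_mx 1%:M 0 1%:M 1%:M.
have e : L *m block_mx c%:M (- 1%:M) (- 1%:M) c%:M *m T
         = block_mx (c - 1)%:M (- 1%:M) 0 (c + 1)%:M.
  rewrite !mulmx_block !mulNmx !mulmxN !mulmx1 !mul1mx !mulmx0 !mul0mx opprK.
  by rewrite !add0r !addr0 !raddfB !raddfD /= subr0 -opprD (addrC 1%:M) addNr.
have := congr1 determinant e.
by rewrite !det_mulmx det_ublock !det_lblock !det1 !det_scalar !mulr1 !mul1r exprMn.
Qed.

Lemma mulmx_const (S : pzSemiRingType) (m p q : nat) (a b : S) :
  (const_mx a : 'M_(m, p)) *m (const_mx b : 'M_(p, q)) = const_mx (a * b *+ p).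
Proof.
apply/matrixP=> i j; rewrite !mxE.
under eq_bigr do rewrite !mxE.
by rewrite sumr_const card_ord.
Qed.

Lemma det_mx2 (S : comPzRingType) (A : 'M[S]_(1 + 1)) :
  \det A = A 0 0 * A 1 1 - A 0 1 * A 1 0.
Proof.
rewrite (expand_det_row _ 0) !big_ord_recl big_ord0 addr0.
rewrite /cofactor !det_mx11 !mxE /= expr0 expr1 mul1r mulN1r mulrN.
have e0 : lift 0 0 = 1 :> 'I_(1 + 1) by apply/val_inj.
have e1 : lift 1 0 = 0 :> 'I_(1 + 1) by apply/val_inj.
have e2 : lift ord0 ord0 = 1 :> 'I_(1 + 1) by apply/val_inj.
by rewrite ?e2 ?e0 ?e1.
Qed.

Lemma det_block11 (S : comPzRingType) (a b c d : 'M[S]_1) :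
  \det (block_mx a b c d) = a 0 0 * d 0 0 - b 0 0 * c 0 0.
Proof.
rewrite det_mx2.
have -> : 0 = lshift 1 0 :> 'I_(1 + 1) by apply/val_inj.
have -> : 1 = rshift 1 0 :> 'I_(1 + 1) by apply/val_inj.
by rewrite block_mxEul block_mxEur block_mxEdl block_mxEdr.
Qed.

(** Instance of [det_sub_mulmx] with [E] block diagonal. The factor [a * (c - 1)] is [\det F], kept
    on the left to avoid dividing. *)
Lemma det_two_cell (S : comPzRingType) (k m : nat) (a c : S) :
  \det (block_mx (a%:M - const_mx 2) (- const_mx 1) (- const_mx 1)
         (block_mx (c%:M - const_mx 1) (- 1%:M - const_mx 1)
                   (- 1%:M - const_mx 1) (c%:M - const_mx 1))
        : 'M_(k + (m + m))) * (a * (c - 1))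
  = a ^+ k * ((c - 1) * (c + 1)) ^+ m
    * ((a - (2 * k)%N%:R) * (c - 1 - (2 * m)%N%:R) - (2 * m)%N%:R * k%:R).
Proof.
pose E : 'M[S]_(k + (m + m)) :=
  block_mx a%:M 0 0 (block_mx c%:M (- 1%:M) (- 1%:M) c%:M).
pose U : 'M[S]_(k + (m + m), 1 + 1) := block_mx (const_mx 1) 0 0 (const_mx 1).
pose V : 'M[S]_(1 + 1, k + (m + m)) :=
  block_mx (const_mx 2) (const_mx 1) (const_mx 1) (const_mx 1).
(* The eigenvalues of [E] on the columns of [U]: each row of the lower block of [E] contains one [c]
   and one [-1], hence sums to [c - 1]. *)
pose F : 'M[S]_(1 + 1) := block_mx a%:M 0 0 (c - 1)%:M.
have EU : E *m U = U *m F.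
  rewrite !mulmx_block !mulmx0 !mul0mx !addr0 !add0r.
  congr (block_mx _ _ _ _).
    by rewrite mul_scalar_mx mul_mx_scalar.
  rewrite mul_mx_scalar -col_mx_const mul_block_col scale_col_mx.
  by rewrite !mulNmx !mul1mx !mul_scalar_mx scalerBl scale1r (addrC (- _)).
have EUV : E - U *m V = block_mx (a%:M - const_mx 2) (- const_mx 1) (- const_mx 1)
         (block_mx (c%:M - const_mx 1) (- 1%:M - const_mx 1)
                   (- 1%:M - const_mx 1) (c%:M - const_mx 1)).
  rewrite mulmx_block !mul0mx !addr0 !add0r !mulmx_const opp_block_mx add_block_mx.
  rewrite !mul1r !mulr1n !add0r; congr (block_mx _ _ _ _).
  have -> : const_mx 1 = block_mx (const_mx 1) (const_mx 1) (const_mx 1) (const_mx 1)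
      :> 'M[S]_(m + m).
    by rewrite block_mx_const.
  by rewrite opp_block_mx add_block_mx.
have := @det_sub_mulmx _ _ _ E U V F EU.
rewrite EUV !det_ublock !det_scalar det_block_scalarN1 !expr1 => ->.
rewrite mulmx_block !mulmx0 !addr0 !add0r !mulmx_const opp_block_mx add_block_mx.
rewrite det_block11 !mxE !eqxx !mulr1n !mulr1 !sub0r mulrNN -mulrnA.
by rewrite addnn -mul2n.
Qed.

(** Once the sizes are identified, [f] is a permutation applied to both rows and columns, so its
    sign occurs twice and cancels. *)
Lemma det_reindex (S : comPzRingType) (m p : nat) (f : 'I_m -> 'I_p) (M : 'M[S]_p) :
  bijective f -> \det (mxsub f f M) = \det M.
Proof.
move=> bf; have e : m = p by have := bij_eq_card bf; rewrite !card_ord.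
move: f bf; rewrite e => f bf.
pose s := perm (bij_inj bf).
have -> : mxsub f f M = row_perm s (col_perm s M).
  by apply/matrixP=> i j; rewrite !mxE !permE.
rewrite row_permE col_permE !det_mulmx !det_perm mulrCA.
by rewrite odd_permV -expr2 sqrr_sign mulr1.
Qed.

(** * The non-commuting graph *)

Section Distance.
Variables (gT : finGroupType) (G : {group gT}).
Hypothesis card_gT : (2 < #|gT|)%N.
Implicit Types u v w : gT.

(** Exposes the radii 0, 1, 2 tried by [nc_dist], so that [find] can be evaluated up to distance
    2. *)
Lemma iota0_gt2 : exists k, iota 0 #|gT| = [:: 0%N, 1%N, 2%N & iota 3 k].
Proof. by case: #|gT| card_gT => [|[|[|k]]] // _; exists k. Qed.

Lemma nc_dist_refl u : nc_dist G u u = 0%N.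
Proof.
by rewrite /nc_dist; have [k ->] := iota0_gt2; rewrite /= in_set1 eqxx.
Qed.

Lemma nc_reach1 u v : v != u -> (v \in nc_reach G 1 u) = nc_adj G u v.
Proof.
move=> vu; rewrite [nc_reach _ _ _]/= in_setU in_set1 (negPf vu) in_set.
apply/andP/idP => [[_ /existsP[w]]|uv]; first by rewrite inE => /andP[/eqP-> ].
split; first by case/and4P: uv.
by apply/existsP; exists u; rewrite inE eqxx.
Qed.

Lemma nc_dist_adj u v : nc_adj G u v -> nc_dist G u v = 1%N.
Proof.
move=> uv; have vu : v != u by case/and4P: uv => _ _; rewrite eq_sym.
rewrite /nc_dist; have [k ->] := iota0_gt2.
by rewrite [find _ _]/= in_set1 (negPf vu) -/(nc_reach G 1 u) nc_reach1 // uv.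
Qed.

Lemma nc_dist_common u v w :
  v != u -> ~~ nc_adj G u v -> nc_adj G u w -> nc_adj G w v -> nc_dist G u v = 2%N.
Proof.
move=> vu nuv uw wv; have wu : w != u by case/and4P: uw => _ _; rewrite eq_sym.
have v2 : v \in nc_reach G 2 u.
  rewrite [nc_reach G 2 u]/= -/(nc_reach G 1 u) inE; apply/orP; right.
  rewrite inE; apply/andP; split; first by case/and4P: wv.
  by apply/existsP; exists w; rewrite nc_reach1 // uw.
rewrite /nc_dist; have [k ->] := iota0_gt2.
rewrite [find _ _]/= in_set1 (negPf vu) -/(nc_reach G 1 u) nc_reach1 //.
by rewrite (negPf nuv) -/(nc_reach G 2 u) v2.
Qed.

End Distance.

(** Replaces the arbitrary order of [enum_val] by a chosen enumeration [f] of the vertices, in which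
    the matrix takes block form. *)
Lemma char_poly_nc_distQ (R : comNzRingType) (gT : finGroupType) (G : {group gT})
    (m : nat) (f : 'I_m -> gT) :
  injective f -> (forall v, (v \in nc_vertices G) = (v \in codom f)) ->
  char_poly (nc_distQ G R)
  = char_poly (\matrix_(i, j) ((i == j)%:R * (\sum_k nc_dist G (f i) (f k))%N%:R
                               + (nc_dist G (f i) (f j))%:R)).
Proof.
move=> injf fV.
have fVi i : f i \in nc_vertices G by rewrite fV codom_f.
pose g (i : 'I_m) := enum_rank_in (fVi i) (f i).
have gK i : enum_val (g i) = f i by rewrite /g enum_rankK_in.
have bg : bijective g.
  apply: inj_card_bij => [i j e|]; first by apply: injf; rewrite -!gK e.
  rewrite !card_ord -[m in (_ <= m)%N]card_ord -(card_codom injf).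
  by apply: subset_leq_card; apply/subsetP=> v; rewrite fV.
rewrite /char_poly -(det_reindex _ bg); congr (\det _).
apply/matrixP=> i j; rewrite !mxE (inj_eq (bij_inj bg)) !gK.
congr (_ - (_ * _%:R + _)%:P).
rewrite /nc_trans (eq_bigl _ _ fV).
(* The transmission becomes a sum over the list of values of [f], which is duplicate-free by
   injectivity. *)
rewrite -big_uniq; last by rewrite map_inj_uniq ?enum_uniq.
by rewrite /image_mem big_map big_enum.
Qed.

(** * Generalized quaternion groups *)

Section Quaternion.
Variables (gT : finGroupType) (G : {group gT}) (x y : gT) (n : nat).
Hypotheses (n_ge2 : (2 <= n)%N) (genG : G :=: <<[set x; y]>>)
  (cardG : #|G| = (4 * n)%N) (x2n : (x ^+ (2 * n) = 1)%g)
  (xn : (x ^+ n = y ^+ 2)%g) (yx : (y * x = x^-1 * y)%g).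
Local Notation X := <[x]>%g.
Implicit Types a b : gT.
Local Open Scope group_scope.

Lemma y_mul a : a \in X -> y * a = a^-1 * y.
Proof.
case/cycleP=> i ->; elim: i => [|i IH]; first by rewrite expg0 invg1 mulg1 mul1g.
by rewrite expgSr mulgA IH -mulgA yx mulgA -invMg -expgS -expgSr.
Qed.

Lemma yy_cycle : y * y \in X.
Proof. by rewrite -expg2 -xn mem_cycle. Qed.

(** The union is closed under products, so it is a group, and it contains both generators. *)
Lemma G_sub_coset_union : G \subset X :|: X :* y.
Proof.
have gs : group_set (X :|: X :* y).
  apply/group_setP; split=> [|u v]; first by rewrite inE group1.
  rewrite !inE => /orP[ux|/rcosetP[a ax ->]] /orP[vx|/rcosetP[b bx ->]].
  - by rewrite groupM.
  - by rewrite orbC mulgA mem_rcoset mulgK groupM.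
  - by rewrite -mulgA y_mul // mulgA mem_rcoset mulgK orbC groupM ?groupV.
  (* Here [a y b y = a b^-1 y^2], and [y^2 = x^n] lies in [X]. *)
  rewrite -mulgA (mulgA y) y_mul // -mulgA mulgA.
  by rewrite groupM ?yy_cycle // groupM ?groupV.
rewrite genG -[X :|: _]/(gval (Group gs)) gen_subG; apply/subsetP=> u.
rewrite !inE => /orP[]/eqP ->; first by rewrite cycle_id.
by rewrite rcoset_refl orbT.
Qed.

(** The relation [x2n] bounds the order above; below, [G] has [4 * n] elements and is covered by two
    cosets of [X]. *)
Lemma order_x : #[x] = (2 * n)%N.
Proof.
apply/eqP; rewrite eqn_leq; apply/andP; split.
  by apply: dvdn_leq; [lia | rewrite order_dvdn x2n].
have := leq_trans (subset_leq_card G_sub_coset_union) (leq_card_setU X (X :* y)).1.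
rewrite card_rcoset cardG -/(order x); lia.
Qed.

Lemma y_notin : y \notin X.
Proof.
apply/negP=> yX; have := subset_leq_card G_sub_coset_union.
by rewrite rcoset_id // setUid cardG -/(order x) order_x; lia.
Qed.

Lemma G_coset_union : G :=: X :|: X :* y.
Proof.
apply/eqP; rewrite eqEcard G_sub_coset_union cardG.
have := (leq_card_setU X (X :* y)).1; rewrite card_rcoset -/(order x) order_x; lia.
Qed.

Lemma x2_neq1 : x ^+ 2 != 1.
Proof.
by rewrite -order_dvdn order_x; apply/negP => /dvdn_leq; lia.
Qed.

Lemma cycle_in_G a : a \in X -> a \in G.
Proof. by rewrite G_coset_union inE => ->. Qed.

Lemma coset_in_G a : a \in X -> a * y \in G.
Proof. by move=> aX; rewrite G_coset_union inE mem_rcoset mulgK aX orbT. Qed.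

(** Moving [a] across [y] inverts it; cancelling [b] and [y] leaves [a = a^-1]. *)
Lemma comm_cycle_coset a b : a \in X -> b \in X ->
  (a * (b * y) == (b * y) * a) = (a ^+ 2 == 1).
Proof.
move=> aX bX; have cab : commute a b by apply: (centsP (cycle_abelian x)).
rewrite -[b * y * a]mulgA (y_mul aX) !mulgA (inj_eq (mulIg _)) cab.
by rewrite (inj_eq (mulgI _)) eq_mulgV1 invgK expg2.
Qed.

(** The two products are [a b^-1 y^2] and [b a^-1 y^2], so the question is whether
    [a b^-1 = b a^-1]. *)
Lemma comm_coset_coset a b : a \in X -> b \in X ->
  ((a * y) * (b * y) == (b * y) * (a * y)) = (a ^+ 2 == b ^+ 2).
Proof.
move=> aX bX; have cab : commute a b by apply: (centsP (cycle_abelian x)).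
have e u v : v \in X -> u * y * (v * y) = u * v^-1 * (y * y).
  by move=> vX; rewrite -mulgA (mulgA y) (y_mul vX) !mulgA.
rewrite !e // (inj_eq (mulIg _)) -(inj_eq (mulgI a)) (mulgA a b) cab mulgK.
by rewrite mulgA -(inj_eq (mulIg b)) mulgKV !expg2.
Qed.

(* The elements of [<[x]>] that are not central in [G]. *)
Definition ncycle := [set a in X | a ^+ 2 != 1].

(** An element of [X] is central exactly when its square is 1, by [comm_cycle_coset]; no [b y] is
    central, because [x ^+ 2 != 1] keeps it from commuting with [x]. *)
Lemma nc_verticesE : nc_vertices G = ncycle :|: X :* y.
Proof.
apply/setP=> u; rewrite /nc_vertices in_setD in_setU [u \in ncycle]in_set.
have -> : (u \in G) = (u \in X) || (u \in X :* y) by rewrite G_coset_union in_setU.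
case uX: (u \in X) => /=.
  have -> : (u \in X :* y) = false.
    apply/negP=> /rcosetP[a aX e]; case/negP: y_notin.
    by rewrite -(groupMl _ aX) -e.
  rewrite andbT orbF; congr (~~ _); apply/idP/idP=> [/centerP[_ c]|u2].
    by rewrite -(comm_cycle_coset uX (group1 _)) mul1g c // -[y]mul1g coset_in_G.
  apply/centerP; split=> [|v]; first exact: cycle_in_G.
  rewrite G_coset_union in_setU => /orP[vX|/rcosetP[b bX ->]].
    exact: (centsP (cycle_abelian x)).
  by apply/eqP; rewrite comm_cycle_coset.
rewrite andbC; case uY: (_ \in _ :* y) => //=; apply/negP=> /centerP[_ c].
case/rcosetP: uY => b bX e; have := comm_cycle_coset (cycle_id x) bX.
by rewrite -e c ?cycle_in_G ?cycle_id // eqxx (negPf x2_neq1).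
Qed.

Lemma card_ncycle : #|ncycle| = (2 * n - 2)%N.
Proof.
(* For [i < 2 * n], [x^i] squares to 1 iff [n] divides [i], which leaves [i = 0] and [i = n]. *)
have -> : ncycle = X :\: [set 1; x ^+ n].
  apply/setP=> u; rewrite in_set in_setD andbC.
  case uX: (u \in X); last by rewrite !andbF.
  rewrite !andbT !inE; congr (~~ _).
  case/cyclePmin: uX => i; rewrite order_x => ltin ->.
  rewrite -expgM -order_dvdn order_x -[1](expg0 x) !eq_expg_mod_order order_x.
  rewrite (mulnC i) dvdn_pmul2l // !modn_small; try lia.
  apply/idP/orP=> [/dvdnP[[|[|k]] e]|[]/eqP->]; last by [].
  - by left; rewrite e.
  - by right; rewrite e mul1n.
  - by move: ltin; rewrite e; nia.
  - by rewrite dvdn0.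
rewrite cardsD (setIidPr _); last first.
  by apply/subsetP=> u; rewrite !inE => /orP[]/eqP ->; rewrite ?group1 ?mem_cycle.
rewrite -/(order x) order_x cards2 -[1](expg0 x) eq_expg_mod_order order_x.
by rewrite !modn_small; lia.
Qed.

Lemma ncycle_cycle a : a \in ncycle -> a \in X. Proof. by rewrite inE => /andP[]. Qed.

Lemma ncycle_vertex a : a \in ncycle -> a \in nc_vertices G.
Proof. by rewrite nc_verticesE in_setU => ->. Qed.

Lemma coset_vertex a : a \in X -> a * y \in nc_vertices G.
Proof. by move=> aX; rewrite nc_verticesE in_setU mem_rcoset mulgK aX orbT. Qed.

(** * Adjacency and distances in the quaternion case *)

Lemma nc_adj_sym u v : nc_adj G u v = nc_adj G v u.
Proof. by rewrite /nc_adj andbCA (eq_sym u) (eq_sym (u * v)). Qed.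

Lemma adj_ncycle_coset a b : a \in ncycle -> b \in X -> nc_adj G a (b * y).
Proof.
move=> aA bX; rewrite /nc_adj ncycle_vertex ?coset_vertex //=.
rewrite (comm_cycle_coset (ncycle_cycle aA) bX).
case/setIdP: aA => aX a2; rewrite a2 andbT; apply: contraNneq y_notin => e.
by rewrite -(groupMl _ bX) -e.
Qed.

Lemma adj_ncycle_ncycle a b : a \in ncycle -> b \in ncycle -> ~~ nc_adj G a b.
Proof.
move=> /ncycle_cycle aX /ncycle_cycle bX; apply/negP=> /and4P[_ _ _ /eqP[]].
exact: (centsP (cycle_abelian x)).
Qed.

Lemma adj_coset_coset a b : a \in X -> b \in X ->
  nc_adj G (a * y) (b * y) = (a ^+ 2 != b ^+ 2).
Proof.
move=> aX bX; rewrite /nc_adj !coset_vertex //= comm_coset_coset // (inj_eq (mulIg _)).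
by case: eqP => [->|]; rewrite ?eqxx.
Qed.

Lemma x_ncycle : x \in ncycle. Proof. by rewrite inE cycle_id x2_neq1. Qed.

Lemma card_gT_gt2 : (2 < #|gT|)%N.
Proof. by apply: leq_trans (max_card (mem G)); rewrite cardG; lia. Qed.

Lemma dist_ncycle_ncycle a b : a \in ncycle -> b \in ncycle ->
  nc_dist G a b = if a == b then 0%N else 2.
Proof.
move=> aA bA; case: eqVneq => [->|ab]; first exact: (nc_dist_refl _ card_gT_gt2).
(* The common neighbour is [y], written as an element of the coset. *)
apply: (nc_dist_common card_gT_gt2 (w := 1 * y));
  rewrite 1?eq_sym ?adj_ncycle_ncycle ?adj_ncycle_coset //.
by rewrite nc_adj_sym adj_ncycle_coset.
Qed.

Lemma dist_ncycle_coset a b : a \in ncycle -> b \in X -> nc_dist G a (b * y) = 1%N.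
Proof. by move=> aA bX; rewrite (nc_dist_adj card_gT_gt2) ?adj_ncycle_coset. Qed.

Lemma dist_coset_ncycle a b : a \in ncycle -> b \in X -> nc_dist G (b * y) a = 1%N.
Proof. by move=> aA bX; rewrite (nc_dist_adj card_gT_gt2) // nc_adj_sym adj_ncycle_coset. Qed.

Lemma dist_coset_coset a b : a \in X -> b \in X ->
  nc_dist G (a * y) (b * y) =
    if a == b then 0%N else if a ^+ 2 == b ^+ 2 then 2 else 1%N.
Proof.
move=> aX bX; case: eqVneq => [->|ab]; first exact: (nc_dist_refl _ card_gT_gt2).
case: eqVneq => ab2; last by rewrite (nc_dist_adj card_gT_gt2) ?adj_coset_coset.
(* Two commuting vertices of the coset have [x] as a common neighbour. *)
apply: (nc_dist_common card_gT_gt2 (w := x)).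
- by rewrite (inj_eq (mulIg _)) eq_sym.
- by rewrite adj_coset_coset // negbK; apply/eqP.
- by rewrite nc_adj_sym adj_ncycle_coset ?x_ncycle.
- by rewrite adj_ncycle_coset ?x_ncycle.
Qed.

(** * Enumeration of the vertices by index blocks *)

Lemma x_expg_eq (i j : nat) : (i < 2 * n)%N -> (j < 2 * n)%N ->
  (x ^+ i == x ^+ j) = (i == j).
Proof. by move=> hi hj; rewrite eq_expg_mod_order order_x !modn_small. Qed.

(** Congruence of [2 * i] and [2 * j] modulo [2 * n] is congruence of [i] and [j] modulo [n]. *)
Lemma x_expg2_eq (i j : nat) :
  ((x ^+ i) ^+ 2 == (x ^+ j) ^+ 2) = (i == j %[mod n]).
Proof.
rewrite -!expgM eq_expg_mod_order order_x !(mulnC _ 2) -!muln_modr.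
by rewrite eqn_pmul2l.
Qed.

(* The last two blocks list [x^i y] and [x^(n+i) y], so that the two vertices of
   index [i] commute. *)
Definition vertex (i : 'I_(#|ncycle| + (n + n))) : gT :=
  match split i with
  | inl a => enum_val a
  | inr j => x ^+ j * y
  end.

Lemma vertex_inj : injective vertex.
Proof.
move=> i j; rewrite /vertex.
case: (split_ordP i) => i' ->; case: (split_ordP j) => j' ->.
- by move/enum_val_inj ->.
- move=> e; case/negP: y_notin.
  by rewrite -(groupMl _ (mem_cycle x j')) -e ncycle_cycle ?enum_valP.
- move=> e; case/negP: y_notin.
  by rewrite -(groupMl _ (mem_cycle x i')) e ncycle_cycle ?enum_valP.
by move/mulIg/eqP; rewrite x_expg_eq ?mul2n -?addnn // => /eqP /ord_inj ->.
Qed.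

Lemma vertex_lshift (i : 'I_#|ncycle|) : vertex (lshift _ i) = enum_val i.
Proof. by rewrite /vertex -[lshift _ i]/(unsplit (inl i)) unsplitK. Qed.

Lemma vertex_rshift (j : 'I_(n + n)) : vertex (rshift _ j) = x ^+ j * y.
Proof. by rewrite /vertex -[rshift _ j]/(unsplit (inr j)) unsplitK. Qed.

Lemma vertex_codom v : (v \in nc_vertices G) = (v \in codom vertex).
Proof.
rewrite nc_verticesE in_setU; apply/orP/codomP => [[vA|/rcosetP[a]]|[i ->]].
- exists (lshift _ (enum_rank_in vA v)).
  by rewrite vertex_lshift enum_rankK_in.
- case/cyclePmin=> i; rewrite order_x mul2n -addnn => lti -> ->.
  by exists (rshift _ (Ordinal lti)); rewrite vertex_rshift.
case: (split_ordP i) => i' ->; first by rewrite vertex_lshift; left; apply: enum_valP.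
by rewrite vertex_rshift; right; rewrite mem_rcoset mulgK mem_cycle.
Qed.

Lemma dist_ll (i j : 'I_#|ncycle|) :
  nc_dist G (vertex (lshift _ i)) (vertex (lshift _ j)) = if i == j then 0%N else 2.
Proof.
by rewrite !vertex_lshift dist_ncycle_ncycle ?enum_valP // (inj_eq enum_val_inj).
Qed.

Lemma dist_lr (i : 'I_#|ncycle|) (j : 'I_(n + n)) :
  nc_dist G (vertex (lshift _ i)) (vertex (rshift _ j)) = 1%N.
Proof.
by rewrite vertex_lshift vertex_rshift dist_ncycle_coset ?enum_valP ?mem_cycle.
Qed.

Lemma dist_rl (i : 'I_#|ncycle|) (j : 'I_(n + n)) :
  nc_dist G (vertex (rshift _ j)) (vertex (lshift _ i)) = 1%N.
Proof.
by rewrite vertex_lshift vertex_rshift dist_coset_ncycle ?enum_valP ?mem_cycle.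
Qed.

Lemma dist_rr (i j : 'I_(n + n)) :
  nc_dist G (vertex (rshift _ i)) (vertex (rshift _ j)) =
    if i == j then 0%N else if i == j %[mod n] then 2 else 1%N.
Proof.
rewrite !vertex_rshift dist_coset_coset ?mem_cycle // x_expg2_eq.
by rewrite x_expg_eq ?mul2n -?addnn.
Qed.

End Quaternion.

(** * Transmissions and the block form of the characteristic matrix *)

Lemma sum_if_eq (m : nat) (i : 'I_m) (a b : nat) :
  (\sum_(j < m) (if i == j then a else b) = a + (m - 1) * b)%N.
Proof.
rewrite (bigD1 i) //= eqxx; congr (_ + _)%N.
under eq_bigr => j ji do rewrite eq_sym (negPf ji).
by rewrite sum_nat_const cardC1 card_ord subn1.
Qed.

Section CharPoly.
Variables (gT : finGroupType) (G : {group gT}) (x y : gT) (n : nat).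
Hypotheses (n_ge2 : (2 <= n)%N) (genG : G :=: <<[set x; y]>>%g)
  (cardG : #|G| = (4 * n)%N) (x2n : (x ^+ (2 * n) = 1)%g)
  (xn : (x ^+ n = y ^+ 2)%g) (yx : (y * x = x^-1 * y)%g).
Local Notation f := (@vertex gT x y n).
Local Notation d := (fun i j => nc_dist G (f i) (f j)).
Local Notation k := #|ncycle x|.

Let dll := dist_ll n_ge2 genG cardG x2n xn yx.
Let dlr := dist_lr n_ge2 genG cardG x2n xn yx.
Let drl := dist_rl n_ge2 genG cardG x2n xn yx.
Let drr := dist_rr n_ge2 genG cardG x2n xn yx.
Let card_k := card_ncycle n_ge2 genG cardG x2n xn yx.

Lemma dist_rr_ll (i j : 'I_n) :
  d (rshift k (lshift n i)) (rshift k (lshift n j)) = if i == j then 0%N else 1%N.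
Proof.
rewrite /= drr (inj_eq (@lshift_inj _ _)) /= !modn_small //.
by case: (i =P j) => // ij; case: eqP => // /ord_inj.
Qed.

Lemma dist_rr_rr (i j : 'I_n) :
  d (rshift k (rshift n i)) (rshift k (rshift n j)) = if i == j then 0%N else 1%N.
Proof.
rewrite /= drr (inj_eq (@rshift_inj _ _)) /= !modnDl !modn_small //.
by case: (i =P j) => // ij; case: eqP => // /ord_inj.
Qed.

(** The matching pairs equal indices of the two halves, so distance 2 occurs on the diagonal of this
    block. *)
Lemma dist_rr_lr (i j : 'I_n) :
  d (rshift k (lshift n i)) (rshift k (rshift n j)) = if i == j then 2 else 1%N.
Proof. by rewrite /= drr eq_lrshift /= modnDl !modn_small. Qed.

Lemma dist_rr_rl (i j : 'I_n) :
  d (rshift k (rshift n i)) (rshift k (lshift n j)) = if i == j then 2 else 1%N.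
Proof. by rewrite /= drr eq_rlshift /= modnDl !modn_small. Qed.

(** There are [2n - 3] vertices at distance 2 and [2n] at distance 1. *)
Lemma trans_l (i : 'I_k) : (\sum_j d (lshift _ i) j = 6 * n - 6)%N.
Proof.
rewrite big_split_ord /=; under eq_bigr do rewrite dll.
under [X in (_ + X)%N]eq_bigr do rewrite dlr.
by rewrite sum_if_eq sum_nat_const card_ord card_k; lia.
Qed.

(** One partner lies at distance 2; the other [4n - 4] vertices, [2n - 2] in each cell, lie at
    distance 1. *)
Lemma trans_r (i : 'I_(n + n)) : (\sum_j d (rshift _ i) j = 4 * n - 2)%N.
Proof.
rewrite big_split_ord /=; under eq_bigr do rewrite drl.
rewrite sum_nat_const card_ord big_split_ord /=.
case: (split_ordP i) => i' ->.
  under eq_bigr do rewrite dist_rr_ll.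
  under [X in (_ + (_ + X))%N]eq_bigr do rewrite dist_rr_lr.
  by rewrite !sum_if_eq card_k; lia.
under eq_bigr do rewrite dist_rr_rl.
under [X in (_ + (_ + X))%N]eq_bigr do rewrite dist_rr_rr.
by rewrite !sum_if_eq card_k; lia.
Qed.

(** The shifts in [a] and [c] absorb the constant matrices: the diagonal entries ['X - (6n - 6)] and
    ['X - (4n - 2)] are [a - 2] and [c - 1]. *)
Lemma char_poly_block (R : comNzRingType) :
  let a : {poly R} := 'X - (6 * n - 8)%N%:R%:P in
  let c : {poly R} := 'X - (4 * n - 3)%N%:R%:P in
  char_poly (nc_distQ G R) =
  \det (block_mx (a%:M - const_mx 2) (- const_mx 1) (- const_mx 1)
         (block_mx (c%:M - const_mx 1) (- 1%:M - const_mx 1)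
                   (- 1%:M - const_mx 1) (c%:M - const_mx 1))
        : 'M_(k + (n + n))).
Proof.
move=> a c.
rewrite (char_poly_nc_distQ _ (vertex_inj n_ge2 genG cardG x2n xn yx)
  (vertex_codom n_ge2 genG cardG x2n xn yx)) /char_poly; congr (\det _).
apply/matrixP=> i j; set B := block_mx _ _ _ _.
(* Stated for a general [M] so that the block matrix on the right stays folded. *)
have -> : forall M : 'M[R]_(k + (n + n)),
    char_poly_mx M i j = 'X *+ (i == j) - (M i j)%:P by move=> M; rewrite !mxE.
rewrite mxE /B.
case: (split_ordP i) => {}i ->; case: (split_ordP j) => {}j ->.
- rewrite block_mxEul trans_l dll (inj_eq (@lshift_inj _ _)) !mxE.
  case: eqP => _; rewrite /= ?mulr1n ?mulr0n ?mul1r ?mul0r ?addr0 ?add0r ?sub0r.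
    rewrite /a !polyC_natr; have -> : (6 * n - 6 = 6 * n - 8 + 2)%N by lia.
    by rewrite natrD opprD addrA.
  by rewrite polyC_natr.
- by rewrite block_mxEur dlr eq_lrshift !mxE /= mulr0n sub0r mul0r add0r polyC1.
- by rewrite block_mxEdl drl eq_rlshift !mxE /= mulr0n sub0r mul0r add0r polyC1.
rewrite block_mxEdr trans_r (inj_eq (@rshift_inj _ _)).
have diag : 'X - (4 * n - 2)%N%:R%:P = c - 1.
  rewrite /c !polyC_natr; have -> : (4 * n - 2 = 4 * n - 3 + 1)%N by lia.
  by rewrite natrD opprD addrA.
case: (split_ordP i) => {}i ->; case: (split_ordP j) => {}j ->.
- rewrite block_mxEul dist_rr_ll (inj_eq (@lshift_inj _ _)) !mxE.
  by case: eqP => _; rewrite /= ?mulr1n ?mulr0n ?mul1r ?mul0r ?addr0 ?add0r ?sub0r.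
- rewrite block_mxEur dist_rr_lr eq_lrshift !mxE.
  case: eqP => _; rewrite /= mulr0n mul0r ?add0r ?oppr0 ?sub0r //.
  by rewrite polyC_natr -opprD.
- rewrite block_mxEdl dist_rr_rl eq_rlshift !mxE.
  case: eqP => _; rewrite /= mulr0n mul0r ?add0r ?oppr0 ?sub0r //.
  by rewrite polyC_natr -opprD.
rewrite block_mxEdr dist_rr_rr (inj_eq (@rshift_inj _ _)) !mxE.
by case: eqP => _; rewrite /= ?mulr1n ?mulr0n ?mul1r ?mul0r ?addr0 ?add0r ?sub0r.
Qed.

End CharPoly.

(** * Vieta's relations and the spectrum *)

Lemma mul_XsubC_vieta (R : comNzRingType) (p q r s t : R) :
  p + q = s + t -> p * q - r = s * t ->
  ('X - p%:P) * ('X - q%:P) - r%:P = ('X - s%:P) * ('X - t%:P).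
Proof.
move=> e1 e2.
(* Solving the two hypotheses for [r] and [p] turns the goal into a ring identity. *)
have -> : r = p * q - s * t by rewrite -e2 subKr.
have -> : p = s + t - q by rewrite -e1 addrK.
by rewrite !(polyCB, polyCM, polyCD); ring.
Qed.

(** Evaluation at 0 gives the product relation and evaluation at 1 then gives the sum; [k] stays as
    a factor, so nothing is divided. *)
Lemma quadratic_vieta (R : comNzRingType) (k b c s t : R) :
  k *: 'X^2 + b *: 'X - c%:P = k *: (('X - s%:P) * ('X - t%:P)) ->
  k * (s + t) = - b /\ k * (s * t) = - c.
Proof.
move=> e.
have h0 := congr1 (horner^~ 0) e; have h1 := congr1 (horner^~ 1) e.
rewrite /= !(hornerD, hornerN, hornerZ, hornerM, hornerXn, hornerX, hornerC) in h0 h1.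
have e0 : k * (s * t) = - c.
  have -> : k * (s * t) = k * ((0 - s) * (0 - t)) by ring.
  by rewrite -h0; ring.
split=> //.
have -> : k * (s + t) = k + k * (s * t) - k * ((1 - s) * (1 - t)) by ring.
by rewrite -h1 e0; ring.
Qed.

Unset Implicit Arguments.

Theorem theorem3p3 (R : rcfType) (gT : finGroupType) (G : {group gT})
    (x y : gT) (n : nat) (t1 t2 : R) :
  (2 <= n)%N ->
  G :=: <<[set x; y]>> ->
  #|G| = (4 * n)%N ->
  (x ^+ (2 * n))%g = 1%g ->
  (x ^+ n)%g = (y ^+ 2)%g ->
  (y * x)%g = (x^-1 * y)%g ->
  (2 * n - 2)%N%:R *: 'X^2 + (10 - 4 * n%:R) *: 'X - (2 * n)%N%:R%:P
    = ((2 * n - 2)%N%:R : R) *: (('X - t1%:P) * ('X - t2%:P)) ->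
  char_poly (nc_distQ G R) =
    ('X - (4 * n - 4)%N%:R%:P) ^+ n
    * ('X - (6 * n - 8)%N%:R%:P) ^+ (2 * n - 3)
    * ('X - (4 * n - 2)%N%:R%:P) ^+ (n - 1)
    * ('X - (t1 * (2 * n - 2)%N%:R + (6 * n - 2)%N%:R)%:P)
    * ('X - (t2 * (2 * n - 2)%N%:R + (6 * n - 2)%N%:R)%:P).
Proof.
move=> n_ge2 genG cardG x2n xn yx tE.
pose a : {poly R} := 'X - (6 * n - 8)%N%:R%:P.
pose b : {poly R} := 'X - (4 * n - 2)%N%:R%:P.
(* This is [\det F] in [det_two_cell], to be cancelled at the end. *)
have ab0 : a * b != 0 by rewrite mulf_neq0 ?polyXsubC_eq0.
have bE : 'X - (4 * n - 3)%N%:R%:P - 1 = b.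
  have e : (4 * n - 2 = 4 * n - 3 + 1)%N by lia.
  by rewrite /b e natrD polyCD opprD addrA.
have bE2 : 'X - (4 * n - 3)%N%:R%:P + 1 = 'X - (4 * n - 4)%N%:R%:P :> {poly R}.
  have e : (4 * n - 3 = 4 * n - 4 + 1)%N by lia.
  by rewrite e natrD polyCD opprD addrA subrK.
(* The left side is the 2 x 2 determinant of [det_two_cell] for cells of sizes [2n - 2] and [2n]. *)
have roots : (a - (2 * (2 * n - 2))%N%:R) * (b - (2 * n)%N%:R)
      - (2 * n)%N%:R * (2 * n - 2)%N%:R
    = ('X - (t1 * (2 * n - 2)%N%:R + (6 * n - 2)%N%:R)%:P)
      * ('X - (t2 * (2 * n - 2)%N%:R + (6 * n - 2)%N%:R)%:P) :> {poly R}.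
  rewrite -natrM -!polyC_natr /a /b -!addrA -!opprD -!polyCD.
  have [sum_t prod_t] := quadratic_vieta tE.
  (* Truncated subtractions are cast to true ones, as [n >= 2] permits. *)
  have -> : (6 * n - 8)%N%:R = 6 * n%:R - 8 :> R by rewrite natrB ?natrM //; lia.
  have -> : (4 * n - 2)%N%:R = 4 * n%:R - 2 :> R by rewrite natrB ?natrM //; lia.
  have -> : (6 * n - 2)%N%:R = 6 * n%:R - 2 :> R by rewrite natrB ?natrM //; lia.
  have kE : (2 * n - 2)%N%:R = 2 * n%:R - 2 :> R by rewrite natrB ?natrM //; lia.
  rewrite ?natrM kE in sum_t prod_t *.
  set N : R := n%:R in sum_t prod_t *; set k := 2 * N - 2 in sum_t prod_t *.
  apply: mul_XsubC_vieta.
    (* The sum and product of the values [t_i * k + (6 * N - 2)] are grouped around [k * (t1 + t2)]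
       and [k * (t1 * t2)], where Vieta applies. *)
    transitivity (k * (t1 + t2) + 2 * (6 * N - 2)); last by ring.
    by rewrite sum_t /k; ring.
  transitivity (k * (k * (t1 * t2)) + (6 * N - 2) * (k * (t1 + t2)) + (6 * N - 2) ^+ 2);
    last by ring.
  by rewrite sum_t prod_t /k; ring.
apply: (mulIf ab0); rewrite (char_poly_block n_ge2 genG cardG x2n xn yx).
rewrite -{1}bE det_two_cell bE bE2 -/a (card_ncycle n_ge2 genG cardG x2n xn yx) roots.
(* One factor [a] and one factor [b] are split off to match [a * b], leaving the exponents [2n - 3]
   and [n - 1]. *)
have ea : a ^+ (2 * n - 2) = a * a ^+ (2 * n - 3).
  by rewrite -exprS; congr (_ ^+ _); lia.
have eb : b ^+ n = b * b ^+ (n - 1) by rewrite -exprS; congr (_ ^+ _); lia.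
by rewrite exprMn ea eb -/a -/b; ring.
Qed.
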